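(* Suppose that every parametric Presburger family (for every $d\ge1$) has Property 3. Then every parametric Presburger family has Property 3a and Property 3b. (The terms are defined in the context.)
   Context: $\mathbb{N}=\{0,1,2,\dots\}$. A function $g:\mathbb{N}\to\mathbb{Q}$ is a quasi-polynomial if there exist a period $m\ge 1$ and polynomials $p_0,\dots,p_{m-1}\in\mathbb{Q}[t]$ with $g(t)=p_i(t)$ whenever $t\equiv i \bmod m$. A function on $\mathbb{N}$ is eventually a quasi-polynomial if there is $T$ such that it agrees with a quasi-polynomial for all $t\ge T$. A set $A\subseteq\mathbb{N}$ is eventually periodic if there exist $T$ and $m\ge1$ such that for all $t\ge T$, $t\in A\iff t+m\in A$. A family $(S_t)_{t\in\mathbb{N}}$ of subsets of $\mathbb{N}^d$ is a parametric Presburger family if the sets $S_t$ can be defined over the natural numbers (all variables, free and quantified, range over $\mathbb{N}$) by one formula, the same for all $t$, built with quantifiers ($\exists,\forall$), boolean operations (and, or, not), and inequalities of the form $\mathbf{a}(t)\cdot\mathbf{x}\le b(t)$, where $\mathbf{x}$ is the vector of variables (free and quantified), $b\in\mathbb{Z}[t]$, and $\mathbf{a}$ is a vector of polynomials in $\mathbb{Z}[t]$; $t$ is a parameter and is not quantified. The free variables of the formula are the $d$ coordinates of the elements of $S_t$. For a family $(S_t)_{t\in\mathbb{N}}$ of subsets of $\mathbb{N}^d$: Property 3: There exists a function $\mathbf{x}:\mathbb{N}\to\mathbb{N}^d$ such that, if $S_t$ is nonempty, then $\mathbf{x}(t)\in S_t$, and the coordinate functions of $\mathbf{x}$ are eventually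 quasi-polynomials. Moreover, the set of $t$ such that $S_t$ is nonempty is eventually periodic. Property 3a: For every $\mathbf{c}\in\mathbb{Z}^d\setminus\{0\}$, there exists a function $\mathbf{x}:\mathbb{N}\to\mathbb{N}^d$ such that, if $\max_{\mathbf{y}\in S_t}\mathbf{c}\cdot\mathbf{y}$ exists, then it is attained at $\mathbf{x}(t)\in S_t$, and the coordinate functions of $\mathbf{x}$ are eventually quasi-polynomials. Moreover, the set of $t$ such that the maximum exists is eventually periodic. Property 3b: For every $k\in\mathbb{N}$, there exist functions $\mathbf{x}_1,\dots,\mathbf{x}_k:\mathbb{N}\to\mathbb{N}^d$ such that, if $|S_t|\ge k$, then $\mathbf{x}_1(t),\dots,\mathbf{x}_k(t)$ are distinct elements of $S_t$, and the coordinate functions of the $\mathbf{x}_i$ are eventually quasi-polynomials. Moreover, the set of $t$ such that $|S_t|\ge k$ is eventually periodic. *)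

(* Defs.v *)
From mathcomp Require Import all_boot all_order all_algebra.
From mathcomp Require Import boolp classical_sets functions cardinality.

Set Implicit Arguments.
Unset Strict Implicit.
Unset Printing Implicit Defensive.

Import Order.TTheory GRing.Theory Num.Theory.
Local Open Scope classical_set_scope.
Local Open Scope ring_scope.

Definition quasi_polynomial (g : nat -> rat) : Prop :=
  exists (m : nat) (p : 'I_m -> {poly rat}), (0 < m)%N /\
    forall (i : 'I_m) (t : nat), t = i %[mod m] -> g t = (p i).[t%:R].

Definition eventually_quasi_polynomial (f : nat -> rat) : Prop :=
  exists (T : nat) (g : nat -> rat), quasi_polynomial g /\
    forall t : nat, (T <= t)%N -> f t = g t.

Definition eventually_periodic (A : set nat) : Prop :=
  exists T m : nat, (0 < m)%N /\
    forall t : nat, (T <= t)%N -> (A t <-> A (t + m)%N).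

(* Points of N^d are row vectors of type 'rV[nat]_d. *)
Definition eqp_coordinates (d : nat) (x : nat -> 'rV[nat]_d) : Prop :=
  forall i : 'I_d, eventually_quasi_polynomial (fun t => (x t 0 i)%:R).

Definition dot (n : nat) (c : 'rV[int]_n) (x : 'rV[nat]_n) : int :=
  \sum_(i < n) c 0 i * (x 0 i)%:Z.

(* [formula n]: formulas whose free variables are x_0, ..., x_(n-1). Under a
   quantifier the bound variable gets index 0 and the others are shifted up. *)
Inductive formula (n : nat) : Type :=
| Leq of 'rV[{poly int}]_n & {poly int}
| Not of formula n
| And of formula n & formula n
| Or of formula n & formula n
| Exists of formula n.+1
| Forall of formula n.+1.

Definition extend (n : nat) (v : nat) (x : 'rV[nat]_n) : 'rV[nat]_n.+1 :=
  \row_i (if unlift ord0 i is Some j then x 0 j else v).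

Fixpoint holds (t : nat) (n : nat) (f : formula n) : 'rV[nat]_n -> Prop :=
  match f with
  | Leq a b => fun x =>
      dot (map_mx (fun p : {poly int} => p.[t%:Z]) a) x <= b.[t%:Z]
  | Not f1 => fun x => ~ holds t f1 x
  | And f1 f2 => fun x => holds t f1 x /\ holds t f2 x
  | Or f1 f2 => fun x => holds t f1 x \/ holds t f2 x
  | Exists f1 => fun x => exists v : nat, holds t f1 (extend v x)
  | Forall f1 => fun x => forall v : nat, holds t f1 (extend v x)
  end.

Definition parametric_presburger (d : nat) (S : nat -> set 'rV[nat]_d) : Prop :=
  exists f : formula d, forall t : nat, S t = [set x | holds t f x].

Definition property3 (d : nat) (S : nat -> set 'rV[nat]_d) : Prop :=
  (exists x : nat -> 'rV[nat]_d,
     (forall t, S t !=set0 -> S t (x t)) /\ eqp_coordinates x)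
  /\ eventually_periodic [set t | S t !=set0].

Definition is_max (d : nat) (c : 'rV[int]_d) (A : set 'rV[nat]_d) (M : int) :
  Prop := (dot c @` A) M /\ ubound (dot c @` A) M.

Definition property3a (d : nat) (S : nat -> set 'rV[nat]_d) : Prop :=
  forall c : 'rV[int]_d, c <> 0 ->
    (exists x : nat -> 'rV[nat]_d,
       (forall t M, is_max c (S t) M -> S t (x t) /\ dot c (x t) = M)
       /\ eqp_coordinates x)
    /\ eventually_periodic [set t | exists M, is_max c (S t) M].

Definition property3b (d : nat) (S : nat -> set 'rV[nat]_d) : Prop :=
  forall k : nat,
    (exists x : 'I_k -> nat -> 'rV[nat]_d,
       (forall t, (`I_k #<= S t)%card ->
          injective (fun i => x i t) /\ forall i, S t (x i t))
       /\ forall i, eqp_coordinates (x i))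
    /\ eventually_periodic [set t | (`I_k #<= S t)%card].

(* Main.v *)
(* The maximizers of c on S_t are the x in S_t such that every y in S_t has
   c . y <= c . x, and the k-tuples of distinct points of S_t form a subset of
   N^(kd); both families are parametric Presburger, and Properties 3a and 3b of S
   are Property 3 of these two families. *)
Require Import Defs.
From mathcomp Require Import all_boot all_order all_algebra.
From mathcomp Require Import boolp classical_sets functions cardinality.

Set Implicit Arguments.
Unset Strict Implicit.
Unset Printing Implicit Defensive.

Import Order.TTheory GRing.Theory Num.Theory.
Local Open Scope classical_set_scope.
Local Open Scope ring_scope.

(** * Closure of parametric Presburger families under the logical operations *)

Lemma parametric_presburgerP d (S : nat -> set 'rV[nat]_d) :
  parametric_presburger S <->
  exists f : formula d, forall t x, S t x <-> holds t f x.
Proof.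
split=> -[f fS]; exists f => t; first by move=> x; rewrite fS.
by apply/predeqP => x; apply: fS.
Qed.

Lemma presburger_ext d (S S' : nat -> set 'rV[nat]_d) :
  (forall t x, S t x <-> S' t x) ->
  parametric_presburger S -> parametric_presburger S'.
Proof.
move=> SS' /parametric_presburgerP[f fS]; apply/parametric_presburgerP.
by exists f => t x; rewrite -SS'.
Qed.

(** Constant coefficients suffice for every inequality that is added to the formula of a family [S];
    the parameter enters only through [S] itself. *)
Lemma presburger_leq d (a : 'rV[int]_d) :
  parametric_presburger (fun=> [set x | dot a x <= 0]).
Proof.
exists (Leq (map_mx polyC a) 0) => t; apply/predeqP => x /=.
rewrite horner0 -map_mx_comp map_mx_id// => z /=.
by rewrite hornerC.
Qed.

(** Formulas have no truth constant; the inequality 0 <= 0, with all coefficients zero, serves as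
    one. *)
Lemma presburger_true d : parametric_presburger (fun=> [set: 'rV[nat]_d]).
Proof.
apply: presburger_ext (presburger_leq 0) => _ x; split=> //= _.
by rewrite /dot big1// => i _; rewrite mxE mul0r.
Qed.

Lemma presburger_not d (S : nat -> set 'rV[nat]_d) :
  parametric_presburger S -> parametric_presburger (fun t => [set x | ~ S t x]).
Proof.
move=> /parametric_presburgerP[f fS]; apply/parametric_presburgerP.
by exists (Not f) => t x /=; rewrite fS.
Qed.

Lemma presburger_and d (S S' : nat -> set 'rV[nat]_d) :
  parametric_presburger S -> parametric_presburger S' ->
  parametric_presburger (fun t => [set x | S t x /\ S' t x]).
Proof.
move=> /parametric_presburgerP[f fS] /parametric_presburgerP[g gS].
by apply/parametric_presburgerP; exists (And f g) => t x /=; rewrite fS gS.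
Qed.

Lemma presburger_or d (S S' : nat -> set 'rV[nat]_d) :
  parametric_presburger S -> parametric_presburger S' ->
  parametric_presburger (fun t => [set x | S t x \/ S' t x]).
Proof.
move=> /parametric_presburgerP[f fS] /parametric_presburgerP[g gS].
by apply/parametric_presburgerP; exists (Or f g) => t x /=; rewrite fS gS.
Qed.

Lemma presburger_exists d (S : nat -> set 'rV[nat]_d.+1) :
  parametric_presburger S ->
  parametric_presburger (fun t => [set x | exists v, S t (extend v x)]).
Proof.
move=> /parametric_presburgerP[f fS]; apply/parametric_presburgerP.
exists (Exists f) => t x /=.
by split=> -[v]; [move/fS|move/fS]; exists v.
Qed.

Lemma presburger_forall d (S : nat -> set 'rV[nat]_d.+1) :
  parametric_presburger S ->
  parametric_presburger (fun t => [set x | forall v, S t (extend v x)]).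
Proof.
move=> /parametric_presburgerP[f fS]; apply/parametric_presburgerP.
by exists (Forall f) => t x /=; split=> Sx v; apply/fS.
Qed.

Lemma presburger_all (I : eqType) (r : seq I) d
    (S : I -> nat -> set 'rV[nat]_d) :
  (forall i, parametric_presburger (S i)) ->
  parametric_presburger (fun t => [set x | forall i, i \in r -> S i t x]).
Proof.
move=> pS; elim: r => [|i r IHr].
  exact: presburger_ext (@presburger_true d).
apply: presburger_ext (presburger_and (pS i) IHr) => t x /=.
split=> [[Six Srx] j|Sx]; first by rewrite inE => /predU1P[->|/Srx].
by split=> [|j jr]; apply: Sx; rewrite inE ?eqxx ?jr ?orbT.
Qed.

Lemma presburger_forall_fin (I : finType) d (S : I -> nat -> set 'rV[nat]_d) :
  (forall i, parametric_presburger (S i)) ->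
  parametric_presburger (fun t => [set x | forall i, S i t x]).
Proof.
move=> /(presburger_all (enum I)); apply: presburger_ext => t x /=.
by split=> Sx i => [|_]; apply: Sx; rewrite mem_enum.
Qed.

Lemma presburger_eq_coord d (i j : 'I_d) :
  parametric_presburger (fun=> [set x | x 0 i = x 0 j]).
Proof.
have dotE (k l : 'I_d) (x : 'rV[nat]_d) :
    dot (delta_mx 0 k - delta_mx 0 l) x = (x 0 k)%:Z - (x 0 l)%:Z.
  have coord (a : 'I_d) : \sum_b (b == a)%:R * (x 0 b)%:Z = (x 0 a)%:Z.
    rewrite (bigD1 a)//= eqxx mul1r big1 ?addr0// => b /negPf->.
    by rewrite mul0r.
  rewrite -(coord k) -(coord l) -sumrB /dot; apply: eq_bigr => b _.
  by rewrite !mxE mulrBl.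
apply: presburger_ext (presburger_and
  (presburger_leq (delta_mx 0 i - delta_mx 0 j))
  (presburger_leq (delta_mx 0 j - delta_mx 0 i))) => _ x /=.
rewrite !dotE !subr_le0 !lez_nat; split=> [[le1 le2]|->//].
by apply/eqP; rewrite eqn_leq le1.
Qed.

(** * Renaming of variables *)

Lemma dot_reindex n m (g : 'I_n -> 'I_m) (a : 'rV[int]_n) (x : 'rV[nat]_m) :
  dot (\row_j \sum_(i | g i == j) a 0 i) x = dot a (\row_i x 0 (g i)).
Proof.
(* Regroup the sum over the fibres of [g]: variables that [g] identifies have their coefficients
   added. *)
rewrite /dot (partition_big g predT)//=; apply: eq_bigr => j _.
by rewrite mxE mulr_suml; apply: eq_bigr => i /eqP <-; rewrite mxE.
Qed.

(** The renaming that [g] induces under a quantifier, where the bound variable keeps index 0. *)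
Definition lift_reindex n m (g : 'I_n -> 'I_m) (i : 'I_n.+1) : 'I_m.+1 :=
  if unlift ord0 i is Some j then lift ord0 (g j) else ord0.

Lemma extend_reindex n m (g : 'I_n -> 'I_m) v (x : 'rV[nat]_m) :
  \row_i extend v x 0 (lift_reindex g i) = extend v (\row_i x 0 (g i)).
Proof.
apply/rowP => i; rewrite !mxE /lift_reindex.
by case: (unliftP ord0 i) => [j _|_]; rewrite ?liftK ?unlift_none ?mxE.
Qed.

(** As [g] need not be surjective, dummy variables can be added: this expresses that one block of a
    longer row lies in [S]. *)
Lemma presburger_reindex n m (g : 'I_n -> 'I_m) (S : nat -> set 'rV[nat]_n) :
  parametric_presburger S ->
  parametric_presburger (fun t => [set x | S t (\row_i x 0 (g i))]).
Proof.
case/parametric_presburgerP=> f fS.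
suff : parametric_presburger
    (fun t => [set x : 'rV_m | holds t f (\row_i x 0 (g i))]).
  by apply: presburger_ext => t x /=; rewrite fS.
(* [m] and [g] stay general because a quantifier turns [g] into [lift_reindex g]. *)
elim: {S} f m g {fS} => {n}
  [n a b|n f IHf|n f IHf f' IHf'|n f IHf f' IHf'|n f IHf|n f IHf] m g.
- exists (Leq (\row_j \sum_(i | g i == j) a 0 i) b) => t.
  apply/predeqP => x /=; rewrite -dot_reindex.
  set a1 := \row_j _; set a2 := map_mx _ _.
  suff -> : a1 = a2 by [].
  apply/rowP => j; rewrite !mxE horner_sum.
  by apply: eq_bigr => i _; rewrite mxE.
- exact: presburger_not (IHf _ g).
- exact: presburger_and (IHf _ g) (IHf' _ g).
- exact: presburger_or (IHf _ g) (IHf' _ g).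
- apply: presburger_ext (presburger_exists (IHf _ (lift_reindex g))) => t x /=.
  by split=> -[v]; [rewrite extend_reindex|rewrite -extend_reindex]; exists v.
- apply: presburger_ext (presburger_forall (IHf _ (lift_reindex g))) => t x /=.
  by split=> Sx v; [rewrite -extend_reindex|rewrite extend_reindex].
Qed.

(** * Quantification over vectors *)

Lemma extend_row_mx m n v (y : 'rV[nat]_m) (x : 'rV[nat]_n) :
  extend v (row_mx y x) = row_mx (extend v y) x.
Proof.
apply/rowP => i; rewrite !mxE.
case: (splitP (i : 'I_(m.+1 + n))) => j ij.
  rewrite mxE; case: (unliftP ord0 j) ij => [k ->|->] ij.
    have -> : i = lift ord0 (lshift n k) :> 'I_(m + n).+1 by apply/val_inj.
    by rewrite liftK row_mxEl.
  have -> : i = ord0 :> 'I_(m + n).+1 by apply/val_inj.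
  by rewrite unlift_none.
have -> : i = lift ord0 (rshift m j) :> 'I_(m + n).+1 by apply/val_inj.
by rewrite liftK row_mxEr.
Qed.

(** A quantifier over a vector amounts to [m] scalar quantifiers, each binding the head of the left
    block. As [m.+1 + n] and [(m + n).+1] are convertible, [presburger_forall] applies to the joined
    row. *)
Lemma presburger_forall_row m n (S : nat -> set 'rV[nat]_(m + n)) :
  parametric_presburger S ->
  parametric_presburger (fun t => [set x | forall y : 'rV_m, S t (row_mx y x)]).
Proof.
elim: m S => [|m IHm] S pS.
  apply: presburger_ext pS => t x /=; split=> [Sx y|/(_ 0)].
    by rewrite (_ : row_mx y x = x)//; apply/rowP => i; rewrite mxE;
       case: splitP => [[]//|j ij]; congr (x 0 _); apply/val_inj.
  rewrite (_ : row_mx 0 x = x)//; apply/rowP => i; rewrite mxE.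
  by case: splitP => [[]//|j ij]; congr (x 0 _); apply/val_inj.
apply: presburger_ext (IHm _ (presburger_forall pS)) => t x /=.
split=> [Sx y|Sx y v]; last by rewrite extend_row_mx.
have -> : y = extend (y 0 ord0) (\row_i y 0 (lift ord0 i)).
  apply/rowP => i; rewrite !mxE; case: unliftP => [j ->|->//].
  by rewrite mxE.
by rewrite -extend_row_mx.
Qed.

(** * Maximizers and Property 3a *)

Lemma dot_row_mx m n (a : 'rV[int]_m) (b : 'rV[int]_n) y x :
  dot (row_mx a b) (row_mx y x) = dot a y + dot b x.
Proof.
rewrite /dot big_split_ord /=; congr (_ + _); apply: eq_bigr => i _.
  by rewrite !row_mxEl.
by rewrite !row_mxEr.
Qed.

Lemma dotN n (a : 'rV[int]_n) x : dot (- a) x = - dot a x.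
Proof. by rewrite /dot -sumrN; apply: eq_bigr => i _; rewrite mxE mulNr. Qed.

(** [is_max] at [dot c x] says only that some point of the set attains this value, so [S t x] is a
    separate condition. *)
Lemma presburger_max d (c : 'rV[int]_d) (S : nat -> set 'rV[nat]_d) :
  parametric_presburger S ->
  parametric_presburger (fun t => [set x | is_max c (S t) (dot c x) /\ S t x]).
Proof.
move=> pS.
(* In the joined row of y and x, maximality of x reads: for all y, either y is not in [S t] or c.y -
   c.x <= 0. This is the first disjunct. *)
have pSy : parametric_presburger
    (fun t => [set z : 'rV_(d + d) | ~ S t (\row_i z 0 (lshift d i))]).
  exact/presburger_not/presburger_reindex.
have := presburger_and
  (presburger_forall_row (presburger_or pSy (presburger_leq (row_mx c (- c)))))
  pS.
apply: presburger_ext => t x /=.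
have lE (y : 'rV[nat]_d) : \row_i row_mx y x 0 (lshift d i) = y.
  by apply/rowP => i; rewrite mxE row_mxEl.
split=> [[maxx Sx]|[[_ maxx] Sx]]; split=> //.
  split; first by exists x.
  move=> _ [y Sy <-]; case: (maxx y); first by rewrite lE.
  rewrite dot_row_mx dotN.
  by rewrite subr_le0.
move=> y; rewrite lE dot_row_mx dotN subr_le0.
by case: (pselect (S t y)) => Sy; [right; apply: maxx; exists y|left].
Qed.

Lemma property3_property3a :
  (forall (d : nat) (S : nat -> set 'rV[nat]_d),
     (0 < d)%N -> parametric_presburger S -> property3 S) ->
  forall (d : nat) (S : nat -> set 'rV[nat]_d),
    (0 < d)%N -> parametric_presburger S -> property3a S.
Proof.
move=> H d S d0 pS c _.
have [[x [Sx x_eqp]] per] := H _ _ d0 (presburger_max c pS).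
(* A point attaining the maximum is a maximizer, so Property 3 of the maximizers yields one whenever
   the maximum exists. *)
have max_ne t M : is_max c (S t) M ->
    [set x | is_max c (S t) (dot c x) /\ S t x] !=set0.
  by move=> maxM; have [[y Sy yM] _] := maxM; exists y; rewrite /= yM.
split.
  exists x; split=> // t M maxM; have [[_ maxx] Stx] := Sx _ (max_ne _ _ maxM).
  (* Both [M] and [dot c (x t)] are maxima of the same set, hence equal. *)
  split=> //; case: maxM => MS maxM; apply/eqP.
  by rewrite eq_le maxx// maxM//; exists (x t).
rewrite (_ : [set t | _] = [set t |
  [set x | is_max c (S t) (dot c x) /\ S t x] !=set0])//.
apply/predeqP => t; split=> [[M /max_ne]//|[y [maxy _]]].
by exists (dot c y).
Qed.

(** * Tuples of distinct points and Property 3b *)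

Lemma card_ge_injectiveP (T : Type) k (A : set T) :
  (`I_k #<= A)%card <->
  exists f : 'I_k -> T, injective f /\ forall i, A (f i).
Proof.
rewrite (card_le_eql card_II); split=> [/card_leP[f]|[f [finj fA]]].
  exists (fun i => val (f (SigSub (mem_setT i)))); split=> [i j|i].
    move=> /val_inj/(inj (mem_setT _) (mem_setT _)).
    exact: (congr1 val).
  exact: set_valP.
have /injfunPex[g] : exists2 g : 'I_k -> T, set_fun setT A g & set_inj setT g.
  by exists f => [i _|i j _ _ /finj].
exact: inj_card_le.
Qed.

(* A k-tuple of points of N^d is encoded as the row vector of length k * d of
   its coordinates. *)
Definition distinct_rows d k (S : nat -> set 'rV[nat]_d) (t : nat) :
    set 'rV[nat]_(k * d) :=
  [set z | injective (fun i => row i (vec_mx z)) /\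
           forall i, S t (row i (vec_mx z))].

(** Membership of row i is [S] reindexed along [mxvec_index i]. Distinctness is a finite conjunction
    over pairs of indices: either the two rows differ in some coordinate or the indices agree. *)
Lemma presburger_distinct_rows k d (S : nat -> set 'rV[nat]_d) :
  parametric_presburger S ->
  parametric_presburger (@distinct_rows d k S).
Proof.
move=> pS.
have rowE (z : 'rV[nat]_(k * d)) i :
    row i (vec_mx z) = \row_j z 0 (mxvec_index i j).
  by apply/rowP => j; rewrite !mxE.
apply: presburger_and; last first.
  apply: presburger_forall_fin => i.
  apply: presburger_ext (presburger_reindex (mxvec_index i) pS) => t z /=.
  by rewrite rowE.
have : parametric_presburger (fun=> [set z : 'rV_(k * d) |
    forall i j, (~ forall l, z 0 (mxvec_index i l) = z 0 (mxvec_index j l)) \/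
    i == j]).
  apply: presburger_forall_fin => i; apply: presburger_forall_fin => j.
  apply: presburger_or.
    apply: presburger_not; apply: presburger_forall_fin => l.
    exact: presburger_eq_coord.
  (* Whether [i == j] holds does not depend on the point, so it becomes a constantly true or
     constantly false formula. *)
  case: (i == j); first exact: presburger_ext (@presburger_true _).
  apply: presburger_ext (presburger_not (@presburger_true _)) => _ x.
  by split=> /= [[]|].
apply: presburger_ext => t z /=; split=> [dz i j|injz i j].
  move/rowP => ij; case: (dz i j) => [[]|/eqP//] l.
  by have := ij l; rewrite !rowE !mxE.
case: (eqVneq i j) => [|ij]; first by right.
left=> ijE; case/eqP: ij; apply: injz; apply/rowP => l.
by rewrite !rowE !mxE.
Qed.

Lemma property3_property3b :
  (forall (d : nat) (S : nat -> set 'rV[nat]_d),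
     (0 < d)%N -> parametric_presburger S -> property3 S) ->
  forall (d : nat) (S : nat -> set 'rV[nat]_d),
    (0 < d)%N -> parametric_presburger S -> property3b S.
Proof.
move=> H d S d0 pS [|k].
  (* For k = 0 tuples would live in dimension 0, which [H] does not cover; the empty tuple works,
     and every set has at least 0 points. *)
  split; first by exists (fun _ _ => 0); split=> [t _|[]//]; split=> [[]//|[]].
  by exists 0%N, 1%N; split=> // t _; rewrite /= II0 !card_ge0.
have [] := H _ _ _ (presburger_distinct_rows k.+1 pS); first by rewrite muln_gt0.
set D := distinct_rows S; move=> [z [Dz z_eqp]] per.
have DP t : (`I_k.+1 #<= S t)%card <-> D t !=set0.
  rewrite card_ge_injectiveP; split=> [[f [finj Sf]]|[y [yinj Sy]]].
    have rE i : row i (vec_mx (mxvec (\matrix_i f i))) = f i.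
      by rewrite mxvecK rowK.
    exists (mxvec (\matrix_i f i)); split=> [i j|i]; rewrite ?rE//.
    exact: finj.
  by exists (fun i => row i (vec_mx y)).
split; last first.
  by rewrite (_ : [set t | _] = [set t | D t !=set0])//; apply/predeqP.
exists (fun i t => row i (vec_mx (z t))); split=> [t /DP/Dz//|i j].
(* Each coordinate of a decoded point is a coordinate of [z t], so it is still eventually
   quasi-polynomial. *)
rewrite (_ : (fun t => _) = (fun t => (z t 0 (mxvec_index i j))%:R)).
  exact: z_eqp.
by apply/funext => t; rewrite !mxE.
Qed.

Theorem theorem3p4
  (H : forall (d : nat) (S : nat -> set 'rV[nat]_d),
     (0 < d)%N -> parametric_presburger S -> property3 S)
  (d : nat) (S : nat -> set 'rV[nat]_d)
  (hd : (0 < d)%N) (hS : parametric_presburger S) :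
  property3a S /\ property3b S.
Proof.
by split; [apply: property3_property3a|apply: property3_property3b].
Qed.
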